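(* Let $M=(\mathcal S,\mathcal A,\mathcal R,p,\gamma)$ be a finite MDP with deterministic dynamics, i.e. there is a function $\mathbb T:\mathcal S\times\mathcal A\to\mathcal R\times\mathcal S$ such that $p(r,s'\mid s,a)=1$ if $(r,s')=\mathbb T(s,a)$ and $p(r,s'\mid s,a)=0$ otherwise. Then for every policy $\pi$, with occupancy $\rho_\pi$ and induced transition probabilities $p_\pi(s,a,r,s')$, the transition-entropy equals the occupancy-entropy: $$H(p_\pi(s,a,r,s'))=H(\rho_\pi(s,a)).$$
   Context: A finite MDP has finite sets of states $\mathcal S$, actions $\mathcal A$ and rewards $\mathcal R$, dynamics $p(r,s'\mid s,a)$ and discount factor $\gamma\in[0,1)$. The occupancy $\rho_\pi(s,a)=p_\pi(s,a)$ is the probability distribution of state-action pairs under the policy $\pi$ interacting with the MDP, and the transition probabilities induced by $\pi$ are $p_\pi(s,a,r,s')=p(r,s'\mid s,a)\,\rho_\pi(s,a)$. The transition-entropy is $$H(p_\pi(s,a,r,s'))=-\sum_{s,a,r,s':\,p_\pi(s,a,r,s')>0}p_\pi(s,a,r,s')\log p_\pi(s,a,r,s')$$ and the occupancy-entropy is $$H(\rho_\pi(s,a))=-\sum_{s,a:\,\rho_\pi(s,a)>0}\rho_\pi(s,a)\log\rho_\pi(s,a).$$ *)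

(* Defs.v *)
From HB Require Import structures.
From mathcomp Require Import all_boot all_order all_algebra.
From mathcomp Require Import all_classical all_reals all_analysis.
Import Order.TTheory GRing.Theory Num.Theory.
Import numFieldNormedType.Exports.

Set Implicit Arguments.
Unset Strict Implicit.
Unset Printing Implicit Defensive.

Local Open Scope classical_set_scope.
Local Open Scope ring_scope.

Record fdist (R : realType) (X : finType) := FDist {
  pmf :> X -> R;
  pmf_ge0 : forall x, 0 <= pmf x;
  pmf_sum1 : \sum_x pmf x = 1 }.

(* [dyn M s a (r, s')] is p(r, s' | s, a).  The reward set is an arbitrary
   finite type: reward values play no role in the entropies. *)
Record mdp (R : realType) (S A Rw : finType) := MDP {
  dyn : S -> A -> fdist R (Rw * S)%type;
  discount : R;
  discount_ge0 : 0 <= discount;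
  discount_lt1 : discount < 1 }.

(* [pi s a] is pi(a | s). *)
Definition policy (R : realType) (S A : finType) := S -> fdist R A.

Definition deterministic (R : realType) (S A Rw : finType)
    (M : mdp R S A Rw) : Prop :=
  exists T : S -> A -> Rw * S, forall s a r s',
    dyn M s a (r, s') = if (r, s') == T s a then 1 else 0.

(* Law of the state-action pair (s_t, a_t) of the process s_0 ~ mu0,
   a_t ~ pi(. | s_t), (r_t, s_{t+1}) ~ p(. | s_t, a_t). *)
Fixpoint sa_law (R : realType) (S A Rw : finType) (M : mdp R S A Rw)
    (mu0 : fdist R S) (pi : policy R S A) (t : nat) (s : S) (a : A) : R :=
  match t with
  | 0 => mu0 s * pi s a
  | t'.+1 => (\sum_s0 \sum_a0 \sum_r
                sa_law M mu0 pi t' s0 a0 * dyn M s0 a0 (r, s)) * pi s a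
  end.

Definition time_weights (R : realType) (w : R ^nat) : Prop :=
  (forall t, 0 <= w t) /\ (series w @ \oo --> (1 : R)).

(* Probability that a pair (s_t, a_t) equals (s, a), for a time step t drawn
   with law w.  The law w fixes the averaging convention: (1 - g) g ^ t gives
   the discounted occupancy (see [discounted_weights]), the uniform law on
   t < n the occupancy of episodes of length n; a stationary mu0 gives the
   stationary (long-run) occupancy for every w. *)
Definition occupancy (R : realType) (S A Rw : finType) (M : mdp R S A Rw)
    (mu0 : fdist R S) (w : R ^nat) (pi : policy R S A) (s : S) (a : A) : R :=
  limn (series (fun t => w t * sa_law M mu0 pi t s a)).

Definition transition_prob (R : realType) (S A Rw : finType)
    (M : mdp R S A Rw) (mu0 : fdist R S) (w : R ^nat) (pi : policy R S A)
    (s : S) (a : A) (r : Rw) (s' : S) : R :=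
  dyn M s a (r, s') * occupancy M mu0 w pi s a.

Definition entropy (R : realType) (X : finType) (f : X -> R) : R :=
  - \sum_(x | 0 < f x) f x * ln (f x).

Definition occupancy_entropy (R : realType) (S A Rw : finType)
    (M : mdp R S A Rw) (mu0 : fdist R S) (w : R ^nat) (pi : policy R S A) : R :=
  entropy (fun x : S * A => occupancy M mu0 w pi x.1 x.2).

Definition transition_entropy (R : realType) (S A Rw : finType)
    (M : mdp R S A Rw) (mu0 : fdist R S) (w : R ^nat) (pi : policy R S A) : R :=
  entropy (fun x : S * A * Rw * S =>
    let: (s, a, r, s') := x in transition_prob M mu0 w pi s a r s').

Lemma discounted_weights (R : realType) (S A Rw : finType)
    (M : mdp R S A Rw) :
  time_weights (fun t => (1 - discount M) * discount M ^+ t).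
Proof.
have g0 := discount_ge0 M; have g1 := discount_lt1 M.
split=> [t|]; first by rewrite mulr_ge0 ?exprn_ge0 // subr_ge0 ltW.
have := @cvg_geometric_series R (1 - discount M) (discount M).
rewrite ger0_norm // => /(_ g1).
by rewrite divff // subr_eq0 gt_eqF.
Qed.

Lemma sa_law_ge0 (R : realType) (S A Rw : finType) (M : mdp R S A Rw)
    (mu0 : fdist R S) (pi : policy R S A) t s a :
  0 <= sa_law M mu0 pi t s a.
Proof.
elim: t s a => [|t IH] s a /=; rewrite mulr_ge0 ?pmf_ge0 //.
do 3 (apply: sumr_ge0 => ? _); by rewrite mulr_ge0 ?pmf_ge0.
Qed.

Lemma sa_law_sum1 (R : realType) (S A Rw : finType) (M : mdp R S A Rw)
    (mu0 : fdist R S) (pi : policy R S A) t :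
  \sum_s \sum_a sa_law M mu0 pi t s a = 1.
Proof.
elim: t => [|t IH] /=.
all: under eq_bigr => s _ do rewrite -mulr_sumr pmf_sum1 mulr1.
- exact: pmf_sum1.
- rewrite exchange_big /= -IH; apply: eq_bigr => s _.
  rewrite exchange_big /=; apply: eq_bigr => a _.
  rewrite exchange_big /= pair_bigA /=.
  under eq_bigr => x _ do rewrite -surjective_pairing.
  by rewrite -mulr_sumr pmf_sum1 mulr1.
Qed.

Lemma occupancy_cvg (R : realType) (S A Rw : finType) (M : mdp R S A Rw)
    (mu0 : fdist R S) (w : R ^nat) (pi : policy R S A) s a :
  time_weights w -> cvgn (series (fun t => w t * sa_law M mu0 pi t s a)).
Proof.
move=> [w0 w1]; have cw : cvgn (series w) by apply/cvg_ex; exists 1.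
apply: (series_le_cvg _ w0 _ cw) => t; first by rewrite mulr_ge0 ?sa_law_ge0.
rewrite -[leRHS]mulr1 ler_wpM2l // -(sa_law_sum1 M mu0 pi t).
rewrite (bigD1 s) //= (bigD1 a) //= -addrA lerDl addr_ge0 //.
  by apply: sumr_ge0 => ? _; exact: sa_law_ge0.
by do 2 (apply: sumr_ge0 => ? _); exact: sa_law_ge0.
Qed.

Lemma occupancy_ge0 (R : realType) (S A Rw : finType) (M : mdp R S A Rw)
    (mu0 : fdist R S) (w : R ^nat) (pi : policy R S A) s a :
  time_weights w -> 0 <= occupancy M mu0 w pi s a.
Proof.
move=> hw; apply: limr_ge; first exact: occupancy_cvg.
apply: nearW => n; apply: sumr_ge0 => t _.
by rewrite mulr_ge0 ?sa_law_ge0 //; case: hw.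
Qed.

Lemma occupancy_sum1 (R : realType) (S A Rw : finType) (M : mdp R S A Rw)
    (mu0 : fdist R S) (w : R ^nat) (pi : policy R S A) :
  time_weights w -> \sum_s \sum_a occupancy M mu0 w pi s a = 1.
Proof.
move=> hw; have [_ w1] := hw.
have h : (fun n => \sum_s \sum_a
    series (fun t => w t * sa_law M mu0 pi t s a) n) @ \oo -->
    \sum_s \sum_a occupancy M mu0 w pi s a.
  apply: cvg_big => [|s _]; first exact: add_continuous.
  apply: cvg_big => [|a _]; first exact: add_continuous.
  exact: occupancy_cvg.
apply: (cvg_unique _ h) => //=.
have -> // : (fun n => \sum_s \sum_a
    series (fun t => w t * sa_law M mu0 pi t s a) n) = series w.
apply/funext => n; rewrite /series /=.
under eq_bigr => s _ do rewrite exchange_big /=.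
rewrite exchange_big /=; apply: eq_bigr => t _.
under eq_bigr => s _ do rewrite -mulr_sumr.
by rewrite -mulr_sumr sa_law_sum1 mulr1.
Qed.

(* Main.v *)
Require Import Defs.
From mathcomp Require Import all_boot all_order all_algebra.
From mathcomp Require Import all_classical all_reals all_analysis.

(** The entropy only sums over points where [f] is positive, so [h] need not be onto: it suffices
    that [h] is injective and that its image contains all those points. *)
Lemma entropy_reindex (R : realType) (X Z : finType) (f : Z -> R)
    (h : X -> Z) (g : Z -> X) :
  cancel h g -> (forall z, (0 < f z)%R -> h (g z) = z) ->
  entropy (fun x => f (h x)) = entropy f.
Proof.
move=> hK gK; congr (- _)%R; symmetry; apply: reindex.
by exists g => [x _|z]; [exact: hK | exact: gK].
Qed.

(* Under deterministic dynamics the transition law is carried by the graph of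
   T, and its value above (s, a) is the occupancy of (s, a); so the two
   entropies are the same sum, reindexed by (s, a) |-> (s, a, T s a). *)
Theorem mainTheorem3 (R : realType) (S A Rw : finType) (M : mdp R S A Rw)
    (mu0 : fdist R S) (w : nat -> R) :
  deterministic M -> time_weights w ->
  forall pi : policy R S A,
    transition_entropy M mu0 w pi = occupancy_entropy M mu0 w pi.
Proof.
move=> [T dynE] _ pi.
pose h (x : S * A) := (x, (T x.1 x.2).1, (T x.1 x.2).2).
rewrite /transition_entropy -(@entropy_reindex _ _ _ _ h (fun z => z.1.1)) //.
- rewrite /occupancy_entropy; congr entropy; apply/funext => -[s a] /=.
  by rewrite /transition_prob dynE -surjective_pairing eqxx GRing.mul1r.
(* On the graph of [T], forgetting [(r, s')] loses nothing, since [T s a] restores it; off the graph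
   the transition probability is 0, against the positivity assumption. *)
- move=> [[[s a] r] s']; rewrite /transition_prob dynE /h /=.
  by case: eqP => [<- //|_]; rewrite GRing.mul0r Order.POrderTheory.ltxx.
Qed.
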